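(* Let $G_1$ be a finite, simple, connected, non-complete graph and let $G_2$ be a finite simple graph. (1) If $G_2$ is connected, then $G_1\circ G_2$ is not super connected. (2) If $G_2$ is disconnected and $|V_0(G_2)|=0$, then $G_1\circ G_2$ is not super connected. (3) If $G_2$ is disconnected with $|V_0(G_2)|\geq 1$ and $G_1$ is super connected, then $G_1\circ G_2$ is super connected.
   Context: All graphs are finite, simple and undirected. For a graph $H$, $V_0(H)$ denotes the set of isolated vertices (vertices of degree $0$) of $H$. For a graph $G$, a set $S\subseteq V(G)$ is a vertex-cut of $G$ if $G-S$ is disconnected or $G-S$ is the trivial graph $K_1$; a minimum vertex-cut is a vertex-cut of minimum cardinality. A graph $G$ is super connected if every minimum vertex-cut $S$ of $G$ isolates a vertex, i.e. $G-S$ has an isolated vertex. The lexicographic product $G_1\circ G_2$ has vertex set $V(G_1)\times V(G_2)$, where $(x_1,y_1)$ and $(x_2,y_2)$ are adjacent if and only if either $x_1x_2\in E(G_1)$, or $x_1=x_2$ and $y_1y_2\in E(G_2)$.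
   Formalization: Part (1) additionally assumes that G_2 has at least two vertices; for G_2 = K_1 the claim fails, since G_1∘K_1 is isomorphic to G_1 and, for example, the path P_3 is connected, non-complete and super connected. *)

(* Defs.v *)
From mathcomp Require Import all_boot.

Set Implicit Arguments.
Unset Strict Implicit.
Unset Printing Implicit Defensive.

Record sgraph := SGraph {
  vertex :> finType;
  adj : rel vertex;
  adj_sym : symmetric adj;
  adj_irrefl : irreflexive adj }.

Section Notions.
Variable G : sgraph.

Definition degree (x : G) : nat := #|[set y | adj x y]|.

Definition V0 : {set G} := [set x | degree x == 0].

Definition complete : Prop := forall x y : G, x != y -> adj x y.

(* The null graph (reachable as G - V(G)) is neither connected nor
   disconnected; K_1 is connected. *)
Definition connected : Prop :=
  0 < #|G| /\ forall x y : G, connect (@adj G) x y.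

Definition disconnected : Prop :=
  exists x y : G, ~~ connect (@adj G) x y.

Definition trivial : Prop := #|G| = 1.

End Notions.

Section Delete.
Variables (G : sgraph) (S : {set G}).

Definition delete_adj : rel {x : G | x \notin S} :=
  fun x y => adj (val x) (val y).

Lemma delete_adj_sym : symmetric delete_adj.
Proof. by move=> x y; rewrite /delete_adj adj_sym. Qed.

Lemma delete_adj_irrefl : irreflexive delete_adj.
Proof. by move=> x; rewrite /delete_adj adj_irrefl. Qed.

Definition delete : sgraph := SGraph delete_adj_sym delete_adj_irrefl.

End Delete.

Section Cuts.
Variable G : sgraph.

Definition vertex_cut (S : {set G}) : Prop :=
  disconnected (delete S) \/ trivial (delete S).

Definition min_vertex_cut (S : {set G}) : Prop :=
  vertex_cut S /\ forall S' : {set G}, vertex_cut S' -> #|S| <= #|S'|.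

Definition super_connected : Prop :=
  forall S : {set G}, min_vertex_cut S ->
    exists x : delete S, x \in V0 (delete S).

End Cuts.

Section Lex.
Variables G1 G2 : sgraph.

Definition lex_adj : rel (G1 * G2) :=
  fun u v => adj u.1 v.1 || (u.1 == v.1) && adj u.2 v.2.

Lemma lex_adj_sym : symmetric lex_adj.
Proof.
by move=> u v; rewrite /lex_adj (adj_sym u.1) (adj_sym u.2) (eq_sym u.1).
Qed.

Lemma lex_adj_irrefl : irreflexive lex_adj.
Proof. by move=> u; rewrite /lex_adj !adj_irrefl andbF. Qed.

Definition lex_product : sgraph := SGraph lex_adj_sym lex_adj_irrefl.

End Lex.

(* Main.v *)
Require Import Defs.
From mathcomp Require Import all_boot.

Set Implicit Arguments.
Unset Strict Implicit.
Unset Printing Implicit Defensive.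

(** For a set [S] of vertices of [G1 o G2], let [T] be the set of the [x]
    whose fibre [{x} * V(G2)] lies inside [S]. The first projection maps
    [G1 o G2 - S] onto [G1 - T], and edges of [G1 - T] lift to edges between
    any two vertices above their ends. Hence a walk of positive length in
    [G1 - T] lifts to a walk between any two vertices above its ends, so that
    two vertices of [G1 o G2 - S] that are not connected lie above vertices
    that are not connected either, or above one isolated vertex of [G1 - T].
    Thus [T] is a vertex-cut as soon as [S] is one. Conversely [S] disconnects
    [G1 o G2] whenever [T] disconnects [G1], which each minimum vertex-cut of
    [G1] does because [G1] is not complete. By counting, the minimum
    vertex-cuts of [G1 o G2] are exactly the sets [T * V(G2)] with [T] a
    minimum vertex-cut of [G1]. Now [G1 o G2 - T * V(G2) = (G1 - T) o G2] has
    an isolated vertex if and only if both [G1 - T] and [G2] have one;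
    therefore [G1 o G2] is super connected if and only if [G1] is and [G2] has
    an isolated vertex. *)

Section IsolatedVertices.
Variable G : sgraph.
Implicit Types x y : G.

Lemma V0Pn x : reflect (exists y, adj x y) (x \notin V0 G).
Proof.
rewrite inE -lt0n.
by apply: (iffP card_gt0P) => -[y xy]; exists y; rewrite inE in xy *.
Qed.

Lemma V0P x : reflect (forall y, ~~ adj x y) (x \in V0 G).
Proof.
apply: (iffP idP) => [isox y | isox].
  by apply: contraL isox => xy; apply/V0Pn; exists y.
by apply: contraT => /V0Pn[y]; rewrite (negbTE (isox y)).
Qed.

Lemma connect_V0 x y : x \in V0 G -> connect (@adj G) x y = (x == y).
Proof.
move/V0P=> isox; apply/idP/eqP=> [|->]; last exact: connect0.
by case/connectP=> -[|z p] //= /andP[xz]; case/negP: (isox z).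
Qed.

Lemma V0_disconnected x : x \in V0 G -> 1 < #|G| -> disconnected G.
Proof.
move=> isox; rewrite -subn_gt0 subn1 -(cardsC1 x) => /card_gt0P[y].
by rewrite !inE eq_sym => neq_xy; exists x, y; rewrite connect_V0.
Qed.

Lemma V0_disconnected_or_trivial x :
  x \in V0 G -> disconnected G \/ trivial G.
Proof.
have [G_gt1 | leG1] := ltnP 1 #|G| => isox.
  by left; apply: V0_disconnected isox _.
by right; apply/eqP; rewrite eqn_leq leG1; apply/card_gt0P; exists x.
Qed.

Lemma connected_V0 : connected G -> 1 < #|G| -> #|V0 G| = 0.
Proof.
move=> [_ conG] G_gt1; apply/eqP; rewrite -leqn0 leqNgt.
apply/negP=> /card_gt0P[x /V0_disconnected/(_ G_gt1)[y [z]]].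
by rewrite conG.
Qed.

End IsolatedVertices.

Lemma homo_connect (T T' : finType) (e : rel T) (e' : rel T') (f : T -> T') :
    {homo f : x y / e x y >-> connect e' x y} ->
  {homo f : x y / connect e x y >-> connect e' x y}.
Proof.
move=> homo_f x y /connectP[p]; elim: p x => [|z p IHp] x /=.
  by move=> _ ->; apply: connect0.
by case/andP=> /homo_f xz zp Dy; apply: connect_trans xz (IHp z zp Dy).
Qed.

Section Surjection.
Variables (H K : sgraph) (f : H -> K).
Hypothesis f_surj : forall x, exists u, f u = x.

Lemma disconnected_preim :
    {homo f : u v / adj u v >-> connect (@adj K) u v} ->
  disconnected K -> disconnected H.
Proof.
move=> homo_f [x [y]]; have [[u <-] [v <-]] := (f_surj x, f_surj y).
by move=> Nuv; exists u, v; apply: contra Nuv; apply: homo_connect.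
Qed.

Hypothesis adj_lift : forall u v, adj (f u) (f v) -> adj u v.

Lemma connect_lift u v x :
  adj (f u) x -> connect (@adj K) x (f v) -> connect (@adj H) u v.
Proof.
move=> ux /connectP[p]; elim: p u x ux => [|y p IHp] u x ux /=.
  by move=> _ Dfv; apply/connect1/adj_lift; rewrite Dfv.
case/andP=> xy yp Dfv; have [w Dx] := f_surj x; rewrite -{x}Dx in ux xy.
exact: connect_trans (connect1 (adj_lift ux)) (IHp w y xy yp Dfv).
Qed.

Lemma connect_lift_V0 u v :
  f u \notin V0 K -> connect (@adj K) (f u) (f v) -> connect (@adj H) u v.
Proof.
case/V0Pn=> x ux uv; apply: connect_lift (ux) (connect_trans (connect1 _) uv).
by rewrite adj_sym.
Qed.

Lemma disconnected_or_trivial_image :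
  disconnected H \/ trivial H -> disconnected K \/ trivial K.
Proof.
case=> [[u [v Nuv]] | /fintype1[u eq_u]].
  have [/V0_disconnected_or_trivial // | NisoK] := boolP (f u \in V0 K).
  by left; exists (f u), (f v); apply: contra Nuv; apply: connect_lift_V0.
apply: (@V0_disconnected_or_trivial _ (f u)); apply/V0P=> x.
have [v <-] := f_surj x; apply: (contra (@adj_lift u v)).
by rewrite (eq_u v) adj_irrefl.
Qed.

End Surjection.

Section VertexCuts.
Variable G : sgraph.
Implicit Types S : {set G}.

Lemma card_delete S : #|delete S| = #|~: S|.
Proof. by rewrite card_sig; apply: eq_card => x; rewrite !inE. Qed.

Definition isolates S : Prop := exists x : delete S, x \in V0 (delete S).

Lemma isolatesP S :
  isolates S <-> exists2 x, x \notin S & forall y, y \notin S -> ~~ adj x y.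
Proof.
split=> [[x /V0P isox] | [x Sx isox]].
  by exists (val x) => [|y Sy]; [exact: valP x | exact: isox (Sub y Sy)].
by exists (Sub x Sx); apply/V0P=> y; apply: isox (valP y).
Qed.

Definition vertex_cutb S : bool :=
  [exists x : delete S, exists y, ~~ connect (@adj (delete S)) x y]
  || (#|delete S| == 1).

Lemma vertex_cutP S : reflect (vertex_cut S) (vertex_cutb S).
Proof. exact: orPP 'exists_'exists_idP eqP. Qed.

Lemma ex_min_vertex_cut S :
  vertex_cut S -> exists T : {set G}, min_vertex_cut T.
Proof.
move/vertex_cutP=> cutS.
case: (arg_minnP (fun T : {set G} => #|T|) cutS) => T /vertex_cutP cutT minT.
by exists T; split=> // T' /vertex_cutP; apply: minT.
Qed.

Lemma completeP :
  reflect (complete G) [forall x : G, forall y, (x != y) ==> adj x y].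
Proof.
apply: (iffP 'forall_forallP) => compG x y; first exact/implyP.
exact/implyP/compG.
Qed.

Hypothesis G_noncomplete : ~ complete G.

Lemma noncomplete_vertex_cut :
  exists2 S : {set G}, vertex_cut S & #|~: S| = 2.
Proof.
move/completeP: G_noncomplete => /forallPn[x /forallPn[y]].
rewrite negb_imply => /andP[neq_xy Nxy].
have card_xy : #|~: ~: [set x; y]| = 2 by rewrite setCK cards2 neq_xy.
exists (~: [set x; y]) => //; left.
have [z isoz] : isolates (~: [set x; y]).
  apply/isolatesP; exists x => [|z]; rewrite !inE ?eqxx // negbK.
  by case/orP=> /eqP->; rewrite ?adj_irrefl.
by apply: V0_disconnected isoz _; rewrite card_delete card_xy.
Qed.

Lemma min_vertex_cut_disconnected S :
  min_vertex_cut S -> disconnected (delete S).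
Proof.
have [S2 cutS2 card_S2] := noncomplete_vertex_cut.
move=> [[//|trivS] /(_ _ cutS2) leSS2].
have card_S : #|~: S| = 1 by rewrite -card_delete.
have := leq_add leSS2 (leqnn 1).
by rewrite -{1}card_S cardsC -(cardsC S2) card_S2 leq_add2l.
Qed.

End VertexCuts.

Section LexProduct.
Variables G1 G2 : sgraph.
Local Notation G := (lex_product G1 G2).
Implicit Types (S : {set G}) (T : {set G1}).

Definition cylinder T : {set G} := setX T [set: G2].

Lemma in_cylinder T (u : G) : (u \in cylinder T) = (u.1 \in T).
Proof. by case: u => x y; rewrite in_setX in_setT andbT. Qed.

Lemma card_cylinder T : #|cylinder T| = #|T| * #|G2|.
Proof. by rewrite cardsX cardsT. Qed.

Lemma isolates_cylinder T :
  isolates (cylinder T) <-> isolates T /\ 0 < #|V0 G2|.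
Proof.
split=> [/isolatesP[[x y]] | [/isolatesP[x Tx isox] /card_gt0P[y /V0P isoy]]].
  rewrite in_cylinder /= => Tx isoxy; split.
    apply/isolatesP; exists x => // z Tz.
    by have := isoxy (z, y); rewrite in_cylinder => /(_ Tz)/norP[].
  apply/card_gt0P; exists y; apply/V0P=> z.
  have := isoxy (x, z); rewrite in_cylinder => /(_ Tx)/norP[_].
  by rewrite /= eqxx.
apply/isolatesP; exists (x, y) => [|[x' y']]; rewrite in_cylinder //= => Tx'.
by rewrite /lex_adj /= (negbTE (isox _ Tx')) (negbTE (isoy _)) andbF.
Qed.

Definition full_fibres S : {set G1} := [set x | [forall y, (x, y) \in S]].

Lemma full_fibresPn S x :
  reflect (exists y, (x, y) \notin S) (x \notin full_fibres S).
Proof. by rewrite inE; apply: forallPn. Qed.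

Lemma cylinderK : 0 < #|G2| -> cancel cylinder full_fibres.
Proof.
case/card_gt0P=> y _ T; apply/setP=> x; rewrite inE.
by apply/forallP/idP=> [/(_ y) | Tx z]; rewrite in_cylinder.
Qed.

Lemma cylinder_full_fibres S : cylinder (full_fibres S) \subset S.
Proof.
by apply/subsetP=> -[x y]; rewrite in_cylinder inE => /forallP/(_ y).
Qed.

Section Projection.
Variable S : {set G}.

Lemma fst_notin_full_fibres (u : delete S) : (val u).1 \notin full_fibres S.
Proof.
by apply/full_fibresPn; exists (val u).2; rewrite -surjective_pairing (valP u).
Qed.

Definition delete_fst (u : delete S) : delete (full_fibres S) :=
  Sub (val u).1 (fst_notin_full_fibres u).

Lemma delete_fst_surj x : exists u, delete_fst u = x.
Proof.
have /full_fibresPn[y Sxy] := valP x.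
by exists (Sub (val x, y) Sxy); apply: val_inj.
Qed.

Lemma delete_fst_adj_lift u v :
  adj (delete_fst u) (delete_fst v) -> adj u v.
Proof. by move=> uv; apply/orP; left. Qed.

Lemma connect_delete_fst u v :
  adj u v -> connect (@adj _) (delete_fst u) (delete_fst v).
Proof.
case/orP=> [uv | /andP[/eqP Duv _]]; first exact: connect1.
by have -> : delete_fst u = delete_fst v by apply: val_inj.
Qed.

Lemma disconnected_full_fibres :
  disconnected (delete (full_fibres S)) -> disconnected (delete S).
Proof. exact: disconnected_preim delete_fst_surj connect_delete_fst. Qed.

Lemma vertex_cut_full_fibres : vertex_cut S -> vertex_cut (full_fibres S).
Proof.
exact: disconnected_or_trivial_image delete_fst_surj delete_fst_adj_lift.
Qed.

End Projection.

Hypotheses (G1_noncomplete : ~ complete G1) (G2_gt0 : 0 < #|G2|).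

Lemma min_vertex_cut_cylinder T :
  min_vertex_cut T -> min_vertex_cut (cylinder T).
Proof.
move=> minT; split=> [|S /vertex_cut_full_fibres/(proj2 minT) leTS].
  left; apply: disconnected_full_fibres; rewrite cylinderK //.
  exact: min_vertex_cut_disconnected.
apply: leq_trans (subset_leq_card (cylinder_full_fibres S)).
by rewrite !card_cylinder leq_mul2r leTS orbT.
Qed.

Lemma min_vertex_cut_lexP S :
  min_vertex_cut S <-> exists2 T, min_vertex_cut T & S = cylinder T.
Proof.
split=> [[cutS minS] | [T minT ->]]; last exact: min_vertex_cut_cylinder.
have cutT := vertex_cut_full_fibres cutS.
have [T0 minT0] := ex_min_vertex_cut cutT.
have leST0 : #|S| <= #|cylinder T0|.
  by apply: minS; case: (min_vertex_cut_cylinder minT0).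
have leTS := subset_leq_card (cylinder_full_fibres S).
exists (full_fibres S).
  split=> // T' /(proj2 minT0); apply: leq_trans.
  by rewrite -(leq_pmul2r G2_gt0) -!card_cylinder (leq_trans leTS).
apply/esym/eqP; rewrite eqEcard cylinder_full_fibres (leq_trans leST0) //.
by rewrite !card_cylinder leq_mul2r (proj2 minT0) ?orbT.
Qed.

Lemma super_connected_lexP :
  super_connected G <-> super_connected G1 /\ 0 < #|V0 G2|.
Proof.
split=> [superG | [superG1 G2_V0] S]; last first.
  case/min_vertex_cut_lexP=> T minT ->.
  by apply/isolates_cylinder; split; first exact: superG1.
have isolatesT T : min_vertex_cut T -> isolates T /\ 0 < #|V0 G2|.
  by move/min_vertex_cut_cylinder/superG/isolates_cylinder.
have [S /ex_min_vertex_cut[T minT] _] := noncomplete_vertex_cut G1_noncomplete.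
by split=> [T' /isolatesT[] | ]; last case: (isolatesT T minT).
Qed.

End LexProduct.

Theorem theorem2p5 (G1 G2 : sgraph)
    (G1_connected : connected G1) (G1_noncomplete : ~ complete G1) :
  [/\ connected G2 -> 1 < #|G2| ->
        ~ super_connected (lex_product G1 G2),
      disconnected G2 -> #|V0 G2| = 0 ->
        ~ super_connected (lex_product G1 G2)
    & disconnected G2 -> 1 <= #|V0 G2| -> super_connected G1 ->
        super_connected (lex_product G1 G2)].
Proof.
have lexP := super_connected_lexP G1_noncomplete.
split=> [conG2 G2_gt1 | [y _] noV0 | [y _] hasV0 superG1].
- by move/(lexP _ (ltnW G2_gt1)); rewrite connected_V0 // => -[].
- have /lexP superP : 0 < #|G2| by apply/card_gt0P; exists y.
  by move/superP; rewrite noV0 => -[].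
- by apply/lexP => //; apply/card_gt0P; exists y.
Qed.
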